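(* Let $\Omega\subset\mathbb R^2$ be a domain and let $f\in L^2(\Omega)$, extended by $0$ to $\mathbb R^2$. For $(x,y)\in\mathbb R^2$ define $V(x),H(y)\ge 0$ by $$V^2(x)=\int_{-\infty}^{\infty}|f(x,y)|^2\,dy,\qquad H^2(y)=\int_{-\infty}^{\infty}|f(x,y)|^2\,dx,$$ and set $$\alpha(x,y)=\frac{V(x)}{H(y)+V(x)},\qquad \beta(x,y)=\frac{H(y)}{H(y)+V(x)},\qquad f_1=\alpha f,\qquad f_2=\beta f,$$ $$u_1(x,y)=\int_{-\infty}^x f_1(s,y)\,ds,\qquad u_2(x,y)=\int_{-\infty}^y f_2(x,t)\,dt.$$ Then $\mathbf u=(u_1,u_2)$ satisfies $\operatorname{div}\mathbf u=f$ and $$\|u_1\|_{L^\infty}\le\|f\|_{L^2},\qquad \|u_2\|_{L^\infty}\le\|f\|_{L^2}.$$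
   Context: The divergence is in the sense of distributions, and functions in $L^2$ and $L^\infty$ are identified when they agree almost everywhere. At points where the quotients defining $\alpha,\beta$ are not defined (namely where $V(x)=H(y)=0$, or where $V(x)$ or $H(y)$ is infinite) one sets $\alpha=\beta=1/2$; this affects $f_1,f_2$ only on a null set. *)

(* Defs.v *)
From HB Require Import structures.
From mathcomp Require Import all_boot all_order all_algebra.
From mathcomp Require Import all_classical all_reals all_analysis.

Set Implicit Arguments.
Unset Strict Implicit.
Unset Printing Implicit Defensive.

Import Order.TTheory GRing.Theory Num.Theory.
Import numFieldNormedType.Exports.

Local Open Scope classical_set_scope.
Local Open Scope ring_scope.

Definition leb1 (R : realType) : {measure set (measurableTypeR R) -> \bar R} :=
  lebesgue_measure.

Definition leb2 (R : realType) :
    {measure set (measurableTypeR R * measurableTypeR R) -> \bar R} :=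
  (@lebesgue_measure R \x @lebesgue_measure R)%E.

Definition domain (R : realType) (Omega : set (R * R)) : Prop :=
  [/\ open Omega, connected Omega & Omega !=set0].

Section Splitting.
Variables (R : realType) (f : R * R -> R).

(* V and H take the value +oo on the null set of lines along which f is not
   square integrable. *)
Definition V (x : R) : \bar R :=
  sqrte (\int[leb1 R]_y (`|f (x, y)| ^+ 2)%:E)%E.

Definition H (y : R) : \bar R :=
  sqrte (\int[leb1 R]_x (`|f (x, y)| ^+ 2)%:E)%E.

Definition degenerate (z : R * R) : bool :=
  [|| (V z.1 == 0%E) && (H z.2 == 0%E), V z.1 == +oo%E | H z.2 == +oo%E].

Definition alpha (z : R * R) : R :=
  if degenerate z then 2^-1
  else fine (V z.1) / (fine (H z.2) + fine (V z.1)).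

Definition beta (z : R * R) : R :=
  if degenerate z then 2^-1
  else fine (H z.2) / (fine (H z.2) + fine (V z.1)).

Definition f1 (z : R * R) : R := alpha z * f z.
Definition f2 (z : R * R) : R := beta z * f z.

(* [Rintegral] is [fine] of the extended real Lebesgue integral, hence total:
   u1 and u2 take a junk finite value at the points of the null set where
   f1, resp. f2, is not integrable along the half-line. *)
Definition u1 (z : R * R) : R := \int[leb1 R]_(s in `]-oo, z.1]) f1 (s, z.2).
Definition u2 (z : R * R) : R := \int[leb1 R]_(t in `]-oo, z.2]) f2 (z.1, t).

End Splitting.

Section DistributionalDivergence.
Variable R : realType.

Definition pdx (phi : R * R -> R) : R * R -> R := fun z => 'D_(1, 0) phi z.
Definition pdy (phi : R * R -> R) : R * R -> R := fun z => 'D_(0, 1) phi z.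

(* All partial derivatives of order <= n exist, and those of order n are
   continuous. *)
Fixpoint Cn (n : nat) (phi : R * R -> R) : Prop :=
  match n with
  | 0%N => continuous phi
  | m.+1 => [/\ forall z, derivable phi z (1, 0),
                forall z, derivable phi z (0, 1),
                Cn m (pdx phi) & Cn m (pdy phi)]
  end.

Definition test_function (phi : R * R -> R) : Prop :=
  (forall n, Cn n phi) /\ compact (closure [set z | phi z != 0]).

(* div u = g in the sense of distributions on the whole plane; meaningful for
   locally integrable u and g. *)
Definition distributional_div (u : R * R -> R * R) (g : R * R -> R) : Prop :=
  forall phi : R * R -> R, test_function phi ->
    \int[leb2 R]_z ((u z).1 * pdx phi z + (u z).2 * pdy phi z)
    = - \int[leb2 R]_z (g z * phi z).

End DistributionalDivergence.

(* Main.v *)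
(** On a horizontal line with 0 < H(y) < oo one has |f_1| <= V(x)|f(x,y)|/H(y),
    so Cauchy-Schwarz gives \int |f_1(x,y)| dx <= ||V||_2 = ||f||_2; lines with
    H(y) = 0 contribute nothing and those with H(y) = oo form a null set.
    Hence |u_1| <= ||f||_2 almost everywhere.  On each such line f_1(.,y) is
    integrable, and exchanging the integrals over {s <= x} gives
    \int u_1 d_x phi dx = - \int f_1 phi dx; integrating in y shows that the
    distributional x-derivative of u_1 is f_1.  Swapping the coordinates turns
    u_2 into u_1, and f_1 + f_2 = f because alpha + beta = 1. *)

Require Import Defs.
From HB Require Import structures.
From mathcomp Require Import all_boot all_order all_algebra.
From mathcomp Require Import all_classical all_reals all_analysis.
From mathcomp Require Import unstable measurable_realfun ess_sup_inf ring lra.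

Set Implicit Arguments.
Unset Strict Implicit.
Unset Printing Implicit Defensive.

Import Order.TTheory GRing.Theory Num.Theory.
Import numFieldNormedType.Exports.

Local Open Scope classical_set_scope.
Local Open Scope ring_scope.

(** * The plane as a measurable and topological space *)

(** The product $\sigma$-algebra contains open sets because each one is a countable union of squares
    with rational centre and half-side $1/(n+1)$. The union below runs over the countable type of
    all such squares; one that leaves [U] contributes the empty set. *)
Lemma open_measurable_prod (R : realType) (U : set (R * R)) :
  open U -> measurable (U : set (measurableTypeR R * measurableTypeR R)).
Proof.
move=> oU.
pose B (i : rat * rat * nat) : set (R * R) :=
  ball (ratr i.1.1 : R) i.2.+1%:R^-1 `*` ball (ratr i.1.2 : R) i.2.+1%:R^-1.
have -> : U = \bigcup_i (if `[< B i `<=` U >] then B i else set0).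
  apply/seteqP; split=> [z Uz|z [i _]]; last first.
    by case: asboolP => // BU; exact: BU.
  have [e /= e0 eU] := (nbhs_ballP _ _).1 (open_nbhs_nbhs (conj oU Uz)).
  have [n ne] : exists n : nat, n.+1%:R^-1 < e / 2 :> R.
    have : \forall n \near \oo, n.+1%:R^-1 < e / 2 :> R.
      by apply: near_infty_natSinv_lt (PosNum _); rewrite divr_gt0.
    by move=> [n _ /(_ n (leqnn n))]; exists n.
  have n0 : (0 : R) < n.+1%:R^-1 by rewrite invr_gt0.
  have dq (x : R) : exists q : rat, ball (ratr q : R) n.+1%:R^-1 x.
    have [y [xy [q _ qy]]] := @dense_rat R (ball x n.+1%:R^-1)
      (ex_intro _ x (ballxx x n0)) (ball_open x _).
    by exists q; apply: ball_sym; rewrite qy.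
  have [p hp] := dq z.1; have [q hq] := dq z.2.
  have BU : B (p, q, n) `<=` U.
    move=> w [/= w1 w2]; apply: eU.
    have ee : n.+1%:R^-1 + n.+1%:R^-1 <= e by rewrite [leRHS](splitr e) lerD // ltW.
    split; apply: (le_ball ee).
      exact: ball_triangle (ball_sym hp) w1.
    exact: ball_triangle (ball_sym hq) w2.
  exists (p, q, n) => //; case: asboolP => // _.
apply: countable_bigcupT_measurable => [|i].
  exact: countableP.
by case: asboolP => _ //; apply: measurableX; exact: measurable_ball.
Qed.

Lemma continuous_measurable_prod (R : realType) (h : R * R -> R) :
  continuous h ->
  measurable_fun [set: measurableTypeR R * measurableTypeR R] h.
Proof.
move=> /continuousP ch; apply: (measurability _ (RGenOpens.measurableE R)).
move=> _ [_ [a [b ->] <-]]; rewrite setTI; apply: open_measurable_prod.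
exact/ch/interval_open.
Qed.

Lemma compact_supp_bounded (R : realType) (h : R * R -> R) (M : R) :
  continuous h ->
  (forall z, (M < `|z.1|) || (M < `|z.2|) -> h z = 0) ->
  exists C, forall z, `|h z| <= C.
Proof.
move=> ch h0.
have cK : compact (`[(- M)%R, M] `*` `[(- M)%R, M] : set (R * R)).
  by apply: compact_setX; exact: segment_compact.
have : bounded_set (h @` (`[(- M)%R, M] `*` `[(- M)%R, M])).
  by apply/compact_bounded/continuous_compact => //; exact: continuous_subspaceT.
(* Boundedness only provides bounds strictly above [N], hence [N + 1]; the maximum with 0 covers the
   points outside the square, where [h] vanishes. *)
move=> [N [_ hN]]; exists (Num.max 0 (N + 1)) => z.
case: (boolP ((M < `|z.1|) || (M < `|z.2|))) => [/h0 ->|].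
  by rewrite normr0 le_max lexx.
rewrite negb_or -!leNgt => /andP[].
rewrite ler_norml => z1; rewrite ler_norml => z2.
apply: (@le_trans _ _ (N + 1)); last by rewrite le_max lexx orbT.
apply: (hN (N + 1)); first by rewrite ltrDl.
by exists z => //; split; rewrite /= in_itv.
Qed.

(** The exterior region is open, so near each of its points [phi] coincides with the zero
    function. *)
Lemma pdx_eq0 (R : realType) (phi : R * R -> R) (M : R) :
  (forall z, (M < `|z.1|) || (M < `|z.2|) -> phi z = 0) ->
  forall z, (M < `|z.1|) || (M < `|z.2|) -> pdx phi z = 0.
Proof.
move=> phi0 z hz; transitivity ('D_(1, 0) (cst 0 : R * R -> R) z); last exact: derive_cst.
apply: near_eq_derive.
have oM : open [set x : R | M < `|x|].
  by have /continuousP/(_ _ (@open_gt R M)) := @norm_continuous R R.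
case/orP: hz => hz.
  have : \forall w \near z, M < `|w.1|.
    by apply: (cvg_fst (open_nbhs_nbhs (conj oM hz))).
  by apply: filterS => w hw; rewrite phi0 // hw.
have : \forall w \near z, M < `|w.2|.
  by apply: (cvg_snd (open_nbhs_nbhs (conj oM hz))).
by apply: filterS => w hw; rewrite phi0 // hw orbT.
Qed.

(** * Integration by parts against a test function on the line *)

Lemma integral_derive1_itvcy (R : realType) (psi : R -> R) (M s : R) :
  (forall x, derivable psi x 1) -> continuous (derive1 psi : R -> R) ->
  (forall x, M < `|x| -> psi x = 0) ->
  (forall x, M < `|x| -> derive1 psi x = 0) ->
  (\int[lebesgue_measure]_(x in `[s, +oo[) (derive1 psi x)%:E = - (psi s)%:E)%E.
Proof.
move=> dpsi cpsi psi0 psi'0.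
have cts : continuous psi.
  by move=> x; exact/differentiable_continuous/derivable1_diffP.
(* Beyond [s], so that $[s,b]$ is nondegenerate, and beyond [M], so that $\psi(b)=0$ and the tail of
   the integral vanishes. *)
pose b := Num.max s M + 1.
have sb : s < b by rewrite /b ltr_pwDr // le_max lexx.
have Mb x : b <= x -> M < `|x|.
  move=> bx; apply: lt_le_trans (ler_norm x); apply: lt_le_trans bx.
  by rewrite /b ltr_pwDr // le_max lexx orbT.
transitivity (\int[lebesgue_measure]_(x in `[s, b]) (derive1 psi x)%:E)%E.
  rewrite integral_mkcond [RHS]integral_mkcond; apply: eq_integral => x _.
  rewrite !patchE !mem_setE !in_itv /= andbT.
  case: ifPn => // sx; case: (leP x b) => //= bx; rewrite psi'0 //.
  exact/Mb/ltW.
rewrite (continuous_FTC2 (F := psi) sb) //.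
- by rewrite psi0 ?sub0e //; exact: Mb.
- exact: continuous_subspaceT.
- split => [x _//||].
  + by apply: cvg_at_right_filter; exact: cts.
  + by apply: cvg_at_left_filter; exact: cts.
Qed.

Lemma supp_integrable (R : realType) (h : R -> R) (M : R) :
  continuous h -> (forall x, M < `|x| -> h x = 0) ->
  (@lebesgue_measure R).-integrable setT (EFin \o h).
Proof.
move=> ch h0.
have : (@lebesgue_measure R).-integrable `[- M, M] (EFin \o h).
  apply: continuous_compact_integrable; first exact: segment_compact.
  exact: continuous_subspaceT.
move=> /(integrable_mkcond (EFin \o h : measurableTypeR R -> _) (measurable_itv `[(- M)%R, M])).1.
apply: eq_integrable => // x _; rewrite patchE mem_setE in_itv /= -ler_norml.
by case: leP => // /h0; rewrite /= => ->.
Qed.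

(** Fubini on the half-plane $\{s\le x\}$: for fixed $s$ the integral of $\psi'$ over $[s,\infty)$
    is $-\psi(s)$. No regularity of $g$ beyond integrability enters. *)
Lemma primitive_by_parts (R : realType) (g psi : R -> R) (M : R) :
  (@lebesgue_measure R).-integrable setT (EFin \o g) ->
  (forall x, derivable psi x 1) -> continuous (derive1 psi : R -> R) ->
  (forall x, M < `|x| -> psi x = 0) ->
  (forall x, M < `|x| -> derive1 psi x = 0) ->
  (\int[lebesgue_measure]_x
     ((\int[lebesgue_measure]_(s in `]-oo, x]) g s)%R * derive1 psi x)%:E =
  \int[lebesgue_measure]_x (- (g x * psi x))%:E)%E.
Proof.
move=> ig dpsi cpsi psi0 psi'0.
set mu := @lebesgue_measure R.
have ipsi' : mu.-integrable setT (EFin \o derive1 psi) by exact: supp_integrable psi'0.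
(* The kernel $g(s)\psi'(x)1_{s\le x}$, with $z=(s,x)$. *)
pose k (z : measurableTypeR R * measurableTypeR R) : \bar R :=
  if z.1 <= z.2 then (g z.1 * derive1 psi z.2)%:E else 0%E.
have mg : measurable_fun setT (g : measurableTypeR R -> R).
  by apply/measurable_EFinP; exact: measurable_int ig.
have mpsi' : measurable_fun setT (derive1 psi : measurableTypeR R -> R).
  exact: continuous_measurable_fun.
have mk0 : measurable_fun setT (fun z : measurableTypeR R * measurableTypeR R =>
    (g z.1 * derive1 psi z.2)%:E).
  apply/measurable_EFinP/measurable_funM.
    exact: (measurableT_comp mg measurable_fst).
  exact: (measurableT_comp mpsi' measurable_snd).
have mk : measurable_fun setT k.
  apply: measurable_fun_ifT => //.
  by apply: measurable_fun_ler; [exact: measurable_fst|exact: measurable_snd].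
(* [k] is dominated by $g(s)\psi'(x)$, whose absolute integral is $\|g\|_1\|\psi'\|_1$. *)
have ik : (mu \x mu)%E.-integrable setT k.
  refine (@le_integrable _ _ _ (mu \x mu)%E setT measurableT k
    (fun z => (g z.1 * derive1 psi z.2)%:E) mk _ _).
    move=> z _; rewrite /k; case: ifPn => // _.
    by rewrite abse0 abse_ge0.
  apply/integrable12ltyP => //=.
  under eq_integral => x _.
    under eq_integral => y _ do rewrite normrM EFinM.
    rewrite ge0_integralZl //; last first.
      by apply/measurable_EFinP; exact: measurableT_comp.
    rewrite muleC.
    over.
  rewrite ge0_integralZl //; last 2 first.
    by apply/measurable_EFinP; exact: measurableT_comp.
    exact: integral_ge0.
  apply: lte_mul_pinfty; first exact: integral_ge0.
    rewrite ge0_fin_numE ?integral_ge0//.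
    by move/integrableP : ipsi' => [].
  by move/integrableP : ig => [].
transitivity (\int[mu]_x \int[mu]_s k (s, x))%E.
  apply: eq_integral => x _; rewrite -RintegralZr //; last first.
    exact: integrableS ig.
  have igx : mu.-integrable `]-oo, x] (fun s => (g s * derive1 psi x)%:E).
    rewrite [X in integrable _ _ X](_ : _ = (fun s => (EFin \o g) s * (derive1 psi x)%:E)%E) //.
    by apply: integrableZr => //; exact: integrableS ig.
  (* The inner integral is finite, so the real-valued integral agrees with the extended one. *)
  rewrite fineK; last exact: integral_fune_fin_num.
  rewrite integral_mkcond; apply: eq_integral => s _.
  by rewrite patchE /k /= mem_setE in_itv.
have kE s : (\int[mu]_x k (s, x) = - (g s * psi s)%:E)%E.
  transitivity (\int[mu]_(x in `[s, +oo[) ((g s)%:E * (derive1 psi x)%:E))%E.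
    rewrite [RHS]integral_mkcond; apply: eq_integral => x _.
    by rewrite patchE /k /= mem_setE in_itv /= andbT EFinM.
  rewrite integralZl //; last exact: integrableS ipsi'.
  by rewrite (integral_derive1_itvcy _ dpsi cpsi psi0 psi'0) EFinM muleN.
rewrite -(Fubini ik).
by apply: eq_integral => s _; rewrite kE.
Qed.

(** * The weights and their measurability *)

Section fix_F.
Variables (R : realType) (F : R * R -> R).
Local Notation T := (measurableTypeR R).
Hypothesis mF : measurable_fun [set: T * T] F.

Lemma V_ge0 (G : R * R -> R) x : (0 <= V G x)%E.
Proof. exact: sqrte_ge0. Qed.

Lemma sqr_V (G : R * R -> R) x :
  (V G x ^+ 2 = \int[leb1 R]_y (`|G (x, y)| ^+ 2)%:E)%E.
Proof. by apply: sqr_sqrte; apply: integral_ge0 => y _; rewrite lee_fin. Qed.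

Lemma measurable_sqr_norm : measurable_fun [set: T * T] (fun z => (`|F z| ^+ 2)%:E).
Proof.
by apply/measurable_EFinP; apply: measurable_funX; exact: measurableT_comp.
Qed.

Lemma measurable_V : measurable_fun [set: T] (V F).
Proof.
(* The square root becomes the power $1/2$, which is measurable on extended reals; Tonelli handles
   the inner integral. *)
rewrite (_ : V F = (fun x => poweR (\int[leb1 R]_y (`|F (x, y)| ^+ 2)%:E) 2^-1)%E).
  apply: (measurableT_comp (measurable_poweR _)).
  apply: (@measurable_fun_fubini_tonelli_F _ _ _ _ _ (@lebesgue_measure R)
    (fun z => (`|F z| ^+ 2)%:E)); first exact: measurable_sqr_norm.
  by move=> z; rewrite lee_fin.
by apply/funext => x; rewrite poweR12_sqrt // integral_ge0.
Qed.

Lemma alpha_ge0 (G : R * R -> R) z : 0 <= alpha G z.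
Proof.
rewrite /alpha; case: ifPn => _ //.
by rewrite divr_ge0 ?addr_ge0 ?fine_ge0 // sqrte_ge0.
Qed.

Lemma beta_ge0 (G : R * R -> R) z : 0 <= beta G z.
Proof.
rewrite /beta; case: ifPn => _ //.
by rewrite divr_ge0 ?addr_ge0 ?fine_ge0 // sqrte_ge0.
Qed.

(** At degenerate points both weights are $1/2$. Elsewhere $V$ and $H$ are finite and not both zero,
    so the common denominator is nonzero. *)
Lemma alphaDbeta (G : R * R -> R) z : alpha G z + beta G z = 1.
Proof.
rewrite /alpha /beta; case: ifPn => [_|]; first by rewrite [RHS](splitr 1) !mul1r.
rewrite !negb_or negb_and => /and3P[VH Voo Hoo].
rewrite -mulrDl addrC divff // paddr_eq0 ?fine_ge0 ?sqrte_ge0 //.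
have fV : V G z.1 \is a fin_num by rewrite ge0_fin_numE ?sqrte_ge0 // ltey.
have fH : H G z.2 \is a fin_num by rewrite ge0_fin_numE ?sqrte_ge0 // ltey.
by rewrite negb_and !fine_eq0 // orbC.
Qed.

Lemma f1Df2 (G : R * R -> R) z : f1 G z + f2 G z = G z.
Proof. by rewrite /f1 /f2 -mulrDl alphaDbeta mul1r. Qed.

Lemma norm_f1_le (G : R * R -> R) z : `|f1 G z| <= `|G z|.
Proof.
rewrite normrM (ger0_norm (alpha_ge0 _ _)) ler_piMl //.
by rewrite -(alphaDbeta G z) lerDl beta_ge0.
Qed.

End fix_F.

(** * Symmetry of the construction under exchange of the coordinates *)

Section swapping.
Variable R : realType.
Implicit Types F : R * R -> R.

Lemma alpha_swap F z : alpha (F \o swap) z = beta F (swap z).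
Proof.
rewrite /alpha /beta /degenerate /=.
(* Exchanging the coordinates exchanges $V$ and $H$ by mere computation. *)
rewrite -[V (F \o swap)]/(H F) -[H (F \o swap)]/(V F).
by rewrite andbC [(H F _ == +oo%E) || _]orbC addrC.
Qed.

Lemma f1_swap F z : f1 (F \o swap) z = f2 F (swap z).
Proof. by rewrite /f1 /f2 alpha_swap. Qed.

Lemma u1_swap F z : u1 (F \o swap) z = u2 F (swap z).
Proof. by rewrite /u1 /u2; apply: eq_Rintegral => s _; rewrite f1_swap. Qed.

End swapping.

(** * Measurability of the weights and of $u_1$ *)

Section measurability.
Variables (R : realType) (F : R * R -> R).
Local Notation T := (measurableTypeR R).
Hypothesis mF : measurable_fun [set: T * T] F.

Lemma measurable_H : measurable_fun [set: T] (H F).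
Proof.
apply: (@measurable_V _ (F \o swap)).
by apply: measurableT_comp mF _; exact: measurable_swap.
Qed.

Lemma measurable_alpha : measurable_fun [set: T * T] (alpha F).
Proof.
have mV : measurable_fun [set: T * T] (fun z => V F z.1).
  by apply: measurableT_comp (measurable_V mF) _; exact: measurable_fst.
have mH : measurable_fun [set: T * T] (fun z => H F z.2).
  by apply: measurableT_comp measurable_H _; exact: measurable_snd.
apply: measurable_fun_ifT => //.
  apply: measurable_or; last apply: measurable_or.
  - by apply: measurable_and; exact: measurable_fun_eqe.
  - exact: measurable_fun_eqe.
  - exact: measurable_fun_eqe.
apply: measurable_funM; first exact: measurableT_comp.
(* The denominator is nonnegative, so its inverse is its power $-1$, including the value 0 at 0. *)
rewrite (_ : (fun _ => _^-1) =
    (fun z => (fine (H F z.2) + fine (V F z.1)) `^ (-1))); last first.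
  by apply/funext => z; rewrite powR_inv1 // addr_ge0 // fine_ge0 // sqrte_ge0.
apply: (measurableT_comp (measurable_powR _)).
by apply: measurable_funD; exact: measurableT_comp.
Qed.

Lemma measurable_f1 : measurable_fun [set: T * T] (f1 F).
Proof. exact: measurable_funM measurable_alpha mF. Qed.

(** Moves the dependence on $x$ from the domain into the integrand, so that $u_1$ becomes a
    parameter integral over a fixed space. *)
Lemma u1E z :
  u1 F z = fine (\int[leb1 R]_s if (s <= z.1)%R then (f1 F (s, z.2))%:E else 0)%E.
Proof.
rewrite /u1 /Rintegral integral_mkcond; congr fine.
by apply: eq_integral => s _; rewrite patchE mem_setE in_itv.
Qed.

(** The integrand is jointly measurable in $(z,s)$ but need not be integrable for every $z$. Tonelli
    is therefore applied to its positive and negative parts separately, and [fine] of the difference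
    is taken. *)
Lemma measurable_u1 : measurable_fun [set: T * T] (u1 F).
Proof.
rewrite (_ : u1 F = (fun z => fine
    (\int[leb1 R]_s if (s <= z.1)%R then (f1 F (s, z.2))%:E else 0)%E)); last first.
  by apply/funext => z; exact: u1E.
apply: measurableT_comp => //.
pose k (w : (T * T) * T) : \bar R :=
  if w.2 <= w.1.1 then (f1 F (w.2, w.1.2))%:E else 0%E.
have mk : measurable_fun [set: (T * T) * T] k.
  have m1 : measurable_fun [set: (T * T) * T] (fun w => w.1.1 : T).
    by apply: measurableT_comp measurable_fst _; exact: measurable_fst.
  have m2 : measurable_fun [set: (T * T) * T] (fun w => w.1.2 : T).
    by apply: measurableT_comp measurable_snd _; exact: measurable_fst.
  have m3 : measurable_fun [set: (T * T) * T] (fun w => w.2 : T).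
    exact: measurable_snd.
  apply: measurable_fun_ifT => //; first exact: measurable_fun_ler.
  apply/measurable_EFinP; apply: measurableT_comp measurable_f1 _.
  exact: measurable_fun_pair.
have mI : measurable_fun [set: T * T] (fun z => (\int[leb1 R]_s k^\+ (z, s) -
    \int[leb1 R]_s k^\- (z, s))%E).
  apply: emeasurable_funB.
    exact: (measurable_fun_fubini_tonelli_F (m2 := @lebesgue_measure R) _
      (measurable_funepos mk) (funepos_ge0 k)).
  exact: (measurable_fun_fubini_tonelli_F (m2 := @lebesgue_measure R) _
    (measurable_funeneg mk) (funeneg_ge0 k)).
move: mI; congr measurable_fun; apply/funext => z; rewrite [RHS]integralE.
by congr (_ - _)%E; apply: eq_integral => s _; rewrite ?funeposE ?funenegE.
Qed.

End measurability.

(** * The bound on almost every line *)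

Section bound.
Variables (R : realType) (F : R * R -> R).
Local Notation T := (measurableTypeR R).
Hypothesis mF : measurable_fun [set: T * T] F.

Let sq (z : T * T) : \bar R := (`|F z| ^+ 2)%:E.
Let WV (x : T) := (\int[leb1 R]_y sq (x, y))%E.
Let WH (y : T) := (\int[leb1 R]_x sq (x, y))%E.
Local Notation I2 := (\int[leb2 R]_z (`|F z| ^+ 2)%:E)%E.

Let msq : measurable_fun setT sq. Proof. exact: measurable_sqr_norm. Qed.
Let sq_ge0 z : (0 <= sq z)%E. Proof. by rewrite lee_fin. Qed.

Let mWV : measurable_fun setT WV.
Proof. exact: (measurable_fun_fubini_tonelli_F (m2 := @lebesgue_measure R)). Qed.

Let mWH : measurable_fun setT WH.
Proof. exact: (measurable_fun_fubini_tonelli_G (m1 := @lebesgue_measure R)). Qed.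

Let WV_ge0 x : (0 <= WV x)%E. Proof. exact: integral_ge0. Qed.
Let WH_ge0 y : (0 <= WH y)%E. Proof. exact: integral_ge0. Qed.

Let integral_WV : (\int[leb1 R]_x WV x = I2)%E.
Proof. by rewrite [RHS](fubini_tonelli1 _ msq sq_ge0). Qed.

Let integral_WH : (\int[leb1 R]_y WH y = I2)%E.
Proof. by rewrite [RHS](fubini_tonelli2 _ msq sq_ge0). Qed.

(** By Tonelli $\int H^2\,dy=\|F\|_2^2$, and an integrable function is finite almost everywhere. *)
Lemma ae_H_fin : (I2 < +oo)%E -> \forall y \ae leb1 R, H F y != +oo%E.
Proof.
move=> I2oo.
have iH : (leb1 R).-integrable setT WH.
  apply/integrableP; split=> //.
  under eq_integral do rewrite gee0_abs//.
  by rewrite integral_WH.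
have := integrable_ae measurableT iH.
apply: filterS => y /(_ Logic.I) Hfin.
suff : H F y \is a fin_num by apply: contraTneq => ->.
by rewrite /H (sqrte_fin_num (WH_ge0 y)).
Qed.

(* AM-GM for V / c and |F| / h stands in for Cauchy-Schwarz: when c is the
   L2 norm of F and h = H y, both summands on the right integrate to 1. *)
Let norm_f1_young (c h x y : R) : 0 < c -> 0 < h -> H F y = h%:E ->
  (`|f1 F (x, y)|%:E <=
   (c / 2)%:E * ((c ^- 2)%:E * WV x + (h ^- 2)%:E * sq (x, y)))%E.
Proof.
move=> c0 h0 Hy; rewrite /f1 /alpha /degenerate /= Hy.
have -> : WV x = (V F x * V F x)%E by rewrite -expe2 sqr_V.
have := V_ge0 F x; case: (V F x) => [v||] //=.
  rewrite lee_fin => v0; rewrite /sq -!EFinM lee_fin.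
  rewrite !eqe (gt_eqF h0) andbF /=.
  rewrite normrM ger0_norm; last by rewrite divr_ge0 ?addr_ge0 // ltW.
  set a := `|F (x, y)|; have a0 : 0 <= a by rewrite normr_ge0.
  apply: (@le_trans _ _ (v / h * a)).
    (* $v/(h+v)\le v/h$. *)
    rewrite ler_wpM2r // ler_wpM2l // lef_pV2 ?posrE ?ltr_pwDl // lerDl //.
  (* The defect in AM-GM is an explicit square. *)
  have -> : c / 2 * (c ^- 2 * (v * v) + h ^- 2 * a ^+ 2) =
     v / h * a + c / 2 * (v / c - a / h) ^+ 2.
    by field; rewrite !gt_eqF.
  by rewrite lerDl mulr_ge0 ?sqr_ge0 // divr_ge0 // ltW.
(* If $V(x)=\infty$, the right-hand side is infinite. *)
move=> _; rewrite mulyy gt0_muley ?lte_fin ?invr_gt0 ?exprn_gt0 //.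
rewrite addye // gt0_muley ?leey // lte_fin divr_gt0 //.
Qed.

Lemma integral_f1_le y : (I2 < +oo)%E -> H F y != +oo%E ->
  (\int[leb1 R]_x `|f1 F (x, y)|%:E <= sqrte I2)%E.
Proof.
move=> I2oo Hy.
have mf : measurable_fun [set: T] (fun x => `|f1 F (x, y)|%:E).
  apply/measurable_EFinP; apply: measurableT_comp => //.
  exact: measurable_fun_pair1 (measurable_f1 mF).
have msqy : measurable_fun [set: T] (fun x => sq (x, y)).
  exact: measurable_fun_pair1 msq.
have HE : WH y = (H F y * H F y)%E.
  by rewrite -[H F _]/(V (F \o swap) _) -expe2 sqr_V.
have H0 : (0 <= H F y)%E := sqrte_ge0 _.
move: HE Hy H0; case Hh : (H F y) => [h||] // HE _; rewrite lee_fin le_eqVlt.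
case/predU1P => [h0|h0].
  (* $H(y)=0$: here $F$, hence $f_1$, vanishes almost everywhere on the line. *)
  have : (\int[leb1 R]_x `|sq (x, y)| = 0)%E.
    under eq_integral do rewrite gee0_abs//.
    by rewrite -/(WH y) HE -h0 mule0.
  move/(ae_eq_integral_abs _ measurableT msqy) => sq0.
  rewrite (ae_eq_integral (cst 0%E) _ measurableT mf (measurable_cst _)).
    by rewrite integral0 sqrte_ge0.
  apply: filterS sq0 => x /(_ Logic.I) /eqP; rewrite /sq /= eqe sqrf_eq0 normr_eq0.
  by move=> /eqP F0 _; rewrite /f1 F0 mulr0 normr0.
(* $H(y)=h>0$: adding [e] makes $c=\|F\|_2+e$ positive even if the norm is zero, so that division by
   [c] is legitimate. *)
apply/lee_addgt0Pr => e e0.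
have [r r0 I2E] : exists2 r : R, 0 <= r & I2 = r%:E.
  exists (fine I2); first by rewrite fine_ge0 // integral_ge0.
  by rewrite fineK // ge0_fin_numE // integral_ge0.
rewrite I2E /=; set c := Num.sqrt r + e.
have c0 : 0 < c by rewrite ltr_wpDl // sqrtr_ge0.
rewrite -EFinD -/c.
have c2 : 0 <= c ^- 2 by rewrite invr_ge0 sqr_ge0.
have h2 : 0 <= h ^- 2 by rewrite invr_ge0 sqr_ge0.
have mc : measurable_fun setT (fun x => (c ^- 2)%:E * WV x)%E.
  exact: measurable_funeM.
have mh : measurable_fun setT (fun x => (h ^- 2)%:E * sq (x, y))%E.
  exact: measurable_funeM.
have ge0c x : (0 <= (c ^- 2)%:E * WV x)%E by rewrite mule_ge0.
have ge0h x : (0 <= (h ^- 2)%:E * sq (x, y))%E by rewrite mule_ge0.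
apply: (@le_trans _ _ (\int[leb1 R]_x
   ((c / 2)%:E * ((c ^- 2)%:E * WV x + (h ^- 2)%:E * sq (x, y))))%E).
  apply: ge0_le_integral => //.
  - by apply: measurable_funeM; exact: emeasurable_funD.
  - by move=> x _; exact: norm_f1_young.
rewrite ge0_integralZl //; last 3 first.
- exact: emeasurable_funD.
- by move=> x _; rewrite adde_ge0.
- by rewrite lee_fin divr_ge0 // ltW.
rewrite ge0_integralD // !ge0_integralZl // integral_WV I2E -/(WH y) HE.
rewrite -!EFinM lee_fin.
have -> : c / 2 * (c ^- 2 * r + h ^- 2 * (h * h)) = c / 2 * (r / c ^+ 2 + 1).
  by field; rewrite !gt_eqF.
(* With $r=\|F\|_2^2\le c^2$ the bound becomes $\frac c2(1+1)=c$. *)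
have : r / c ^+ 2 <= 1.
  rewrite ler_pdivrMr ?exprn_gt0 // mul1r -(sqr_sqrtr r0) ler_sqr ?nnegrE.
  - by rewrite lerDl ltW.
  - exact: sqrtr_ge0.
  - exact: ltW.
by move: c0; set q := r / _; nra.
Qed.

Lemma norm_u1_le z : (I2 < +oo)%E -> H F z.2 != +oo%E ->
  (`|u1 F z|%:E <= sqrte I2)%E.
Proof.
move=> I2oo Hy.
have mf : measurable_fun [set: T] (fun x => (f1 F (x, z.2))%:E).
  by apply/measurable_EFinP; exact: measurable_fun_pair1 (measurable_f1 mF).
apply: le_trans (integral_f1_le I2oo Hy).
apply: (@le_trans _ _ `|\int[leb1 R]_(s in `]-oo, z.1]) (f1 F (s, z.2))%:E|%E).
  (* Were the integral infinite, [fine] would return 0 and the inequality would still hold. *)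
  by rewrite /u1 /Rintegral; case: integral => [r||] //=; rewrite normr0 leey.
apply: (@le_trans _ _ (\int[leb1 R]_(s in `]-oo, z.1]) `|(f1 F (s, z.2))%:E|)%E).
  by apply: le_abse_integral => //; exact: measurable_funS mf.
apply: ge0_subset_integral => //.
exact: measurableT_comp mf.
Qed.

End bound.

(** * Integration by parts in the plane *)

Section plane.
Variable R : realType.
Local Notation T := (measurableTypeR R).

Lemma ae_leb2S (P Q : T * T -> Prop) : (forall z, P z -> Q z) ->
  (\forall z \ae leb2 R, P z) -> \forall z \ae leb2 R, Q z.
Proof. exact: (@filterS _ (almost_everywhere (leb2 R)) _ P Q). Qed.

(** The exceptional set lies in $\mathbb R\times N$, of measure $\infty\cdot 0=0$. *)
Lemma ae_leb2_snd (P : T -> Prop) :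
  (\forall y \ae leb1 R, P y) -> \forall z \ae leb2 R, P z.2.
Proof.
move=> [N [mN N0 PN]]; exists (setT `*` N); split.
- exact: measurableX.
- by rewrite /leb2 /= product_measure1E // [X in (_ * X)%E]N0 mule0.
- by move=> [x y] /= Py; split => //; exact: PN.
Qed.

Lemma ae_leb2_fst (P : T -> Prop) :
  (\forall x \ae leb1 R, P x) -> \forall z \ae leb2 R, P z.1.
Proof.
move=> [N [mN N0 PN]]; exists (N `*` setT); split.
- exact: measurableX.
- by rewrite /leb2 /= product_measure1E // [X in (X * _)%E]N0 mul0e.
- by move=> [x y] /= Py; split => //; exact: PN.
Qed.

Lemma measurable_comp_swap d (U : measurableType d) (g : T * T -> U) :
  measurable_fun setT g -> measurable_fun setT (g \o swap).
Proof. by move=> mg; apply: measurableT_comp mg _; exact: measurable_swap. Qed.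

Lemma swapK (A B : Type) : cancel (@swap A B) swap.
Proof. by case. Qed.

(** Tonelli in opposite orders reduces both sides to the same iterated integral. *)
Lemma ge0_integral_swap (g : T * T -> \bar R) :
  measurable_fun setT g -> (forall z, 0 <= g z)%E ->
  (\int[leb2 R]_z g (swap z) = \int[leb2 R]_z g z)%E.
Proof.
move=> mg g0; have mgs := measurable_comp_swap mg.
rewrite [RHS](fubini_tonelli2 _ mg g0).
by rewrite [LHS](fubini_tonelli1 _ mgs (fun z => g0 (swap z))).
Qed.

Lemma integrable_swap (g : T * T -> \bar R) :
  (leb2 R).-integrable setT g -> (leb2 R).-integrable setT (g \o swap).
Proof.
move=> /integrableP[mg goo]; apply/integrableP; split.
  exact: measurable_comp_swap.
have mag : measurable_fun setT (abse \o g) by exact: measurableT_comp.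
by rewrite (ge0_integral_swap mag (fun z => abse_ge0 (g z))).
Qed.

Lemma integral_swap (g : T * T -> \bar R) :
  (leb2 R).-integrable setT g ->
  (\int[leb2 R]_z g (swap z) = \int[leb2 R]_z g z)%E.
Proof.
move=> ig; have igs := integrable_swap ig.
transitivity (\int[leb1 R]_x \int[leb1 R]_y g (y, x))%E.
  by rewrite -[LHS](integral12_prod_meas1 igs).
by rewrite -[RHS](integral21_prod_meas1 ig).
Qed.

(** [h] is bounded on a square of finite measure and zero outside it. *)
Lemma supp_integrable2 (h : R * R -> R) (M : R) : continuous h ->
  (forall z, (M < `|z.1|) || (M < `|z.2|) -> h z = 0) ->
  (leb2 R).-integrable setT (EFin \o h).
Proof.
move=> ch h0.
have [C hC] := compact_supp_bounded ch h0.
pose I : set T := `[- M, M]%classic.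
have mI : measurable (I `*` I) by apply: measurableX; exact: measurable_itv.
have iI : (leb2 R).-integrable (I `*` I) (EFin \o h).
  apply: measurable_bounded_integrable => //.
  - rewrite /leb2 /= product_measure1E; [|exact: measurable_itv..].
    have IM : (@lebesgue_measure R `[(- M)%R, M] < +oo)%E.
      by rewrite lebesgue_measure_itv /=; case: ifP; rewrite ?ltry.
    by apply: lte_mul_pinfty; rewrite ?ge0_fin_numE.
  - exact: measurable_funS (continuous_measurable_prod ch).
  - by exists C; split; [exact: num_real|move=> r /ltW Cr z _; exact: le_trans Cr].
have := (@integrable_mkcond _ _ _ (leb2 R) _ (EFin \o h) mI).1 iI.
apply: eq_integrable => // z _; rewrite patchE.
case: ifPn => // /negP; rewrite inE /= => Iz; rewrite h0 //.
apply: contra_notT Iz; rewrite negb_or -!leNgt => /andP[].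
by rewrite ler_norml => z1; rewrite ler_norml => z2; split; rewrite /I /= in_itv.
Qed.

Lemma ae_bounded_mul_integrable (b h : R * R -> R) (N : R) :
  measurable_fun [set: T * T] b ->
  (\forall z \ae leb2 R, `|b z| <= N) ->
  (leb2 R).-integrable setT (EFin \o h) ->
  (leb2 R).-integrable setT (fun z => (b z * h z)%:E).
Proof.
move=> mb bN ih.
have mh : measurable_fun [set: T * T] h.
  by apply/measurable_EFinP; exact: measurable_int ih.
have mbh : measurable_fun [set: T * T] (fun z => (b z * h z)%:E).
  by apply/measurable_EFinP; exact: measurable_funM.
apply/integrableP; split => //.
apply: (@le_lt_trans _ _ (\int[leb2 R]_z `|((Num.max N 0) * h z)%:E|)%E).
  apply: ae_ge0_le_integral => //.
  - exact: measurableT_comp.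
  - apply: measurableT_comp => //.
    by apply/measurable_EFinP; exact: measurable_funM.
  - apply: ae_leb2S bN => z bz _ /=; rewrite lee_fin !normrM ler_wpM2r //.
    by rewrite (le_trans bz) // (le_trans _ (ler_norm _)) // le_max lexx.
under eq_integral do rewrite EFinM.
by have /integrableP[] := integrableZl measurableT (Num.max N 0) ih.
Qed.

End plane.

Section by_parts.
Variables (R : realType) (F : R * R -> R).
Local Notation T := (measurableTypeR R).
Hypothesis mF : measurable_fun [set: T * T] F.
Hypothesis F2 : (\int[leb2 R]_z (`|F z| ^+ 2)%:E < +oo)%E.
Variables (phi : R * R -> R) (M : R).
Hypothesis cphi : continuous phi.
Hypothesis dphi : forall z, derivable phi z (1, 0).
Hypothesis cpdx : continuous (pdx phi).
Hypothesis phi0 : forall z, (M < `|z.1|) || (M < `|z.2|) -> phi z = 0.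

Let mphi := continuous_measurable_prod cphi.

(** Since $(x,y)+h(1,0)=(x+h,y)$, the partial derivative in the first variable is the ordinary
    derivative of the section, to which the one-dimensional result applies. *)
Let quotient_section (x y : R) :
  (fun h : R => h^-1 *: ((phi \o shift (x, y)) (h *: ((1 : R), (0 : R))) - phi (x, y))) =
  (fun h : R => h^-1 *: (((fun s => phi (s, y)) \o shift x) (h *: (1 : R)) - phi (x, y))).
Proof.
apply/funext => h; congr (_ *: (_ - _)).
by congr phi; congr pair => /=; rewrite scaler0 add0r.
Qed.

Lemma derivable_section (x y : R) : derivable (fun s : R => phi (s, y)) x 1.
Proof. by have := @dphi (x, y); rewrite /derivable quotient_section. Qed.

Lemma derive1_section (x y : R) : derive1 (fun s : R => phi (s, y)) x = pdx phi (x, y).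
Proof. by rewrite derive1E /pdx /derive quotient_section. Qed.

(** $|f_1\varphi|\le|F||\varphi|\le|F|^2+\varphi^2$, a sum of integrable functions. *)
Lemma f1_mul_integrable : (leb2 R).-integrable setT (fun z => (f1 F z * phi z)%:E).
Proof.
have mf1 := measurable_f1 mF.
have iF2 : (leb2 R).-integrable setT (fun z => (`|F z| ^+ 2)%:E).
  apply/integrableP; split; first exact: measurable_sqr_norm.
  by under eq_integral do rewrite gee0_abs ?lee_fin//.
have iphi2 : (leb2 R).-integrable setT (fun z => (phi z ^+ 2)%:E).
  apply: (@supp_integrable2 _ (fun z => phi z ^+ 2) M).
    by move=> z; apply: (@continuousM _ _ phi phi z); exact: cphi.
  by move=> z /phi0 ->; rewrite expr0n.
apply: le_integrable (integrableD measurableT iF2 iphi2) => //.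
  by apply/measurable_EFinP; exact: measurable_funM.
move=> z _ /=; rewrite lee_fin [leRHS]ger0_norm ?addr_ge0 ?sqr_ge0 //.
rewrite normrM -(real_normK (num_real (phi z))).
apply: (@le_trans _ _ (`|F z| * `|phi z|)); first by rewrite ler_wpM2r // norm_f1_le.
by have := normr_ge0 (F z); have := normr_ge0 (phi z); nra.
Qed.

(** $u_1$ is essentially bounded by $\|F\|_2$, and $\partial_x\varphi$ is continuous and vanishes
    outside a square. *)
Lemma u1_mul_integrable :
  (leb2 R).-integrable setT (fun z => (u1 F z * pdx phi z)%:E).
Proof.
apply: (@ae_bounded_mul_integrable _ _ _
  (fine (sqrte (\int[leb2 R]_z (`|F z| ^+ 2)%:E)))).
- exact: measurable_u1.
- have := ae_leb2_snd (ae_H_fin mF F2); apply: ae_leb2S => z Hz.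
  rewrite -lee_fin fineK; first exact: norm_u1_le.
  by rewrite sqrte_fin_num ?ge0_fin_numE ?integral_ge0.
- exact: supp_integrable2 cpdx (pdx_eq0 phi0).
Qed.

Lemma u1_by_parts :
  \int[leb2 R]_z (u1 F z * pdx phi z) = \int[leb2 R]_z (- (f1 F z * phi z)).
Proof.
have iu := u1_mul_integrable.
have ifp : (leb2 R).-integrable setT (fun z => (- (f1 F z * phi z))%:E).
  by under eq_fun do rewrite EFinN; exact: (integrableN f1_mul_integrable).
rewrite /Rintegral; congr fine.
(* Integrating in $x$ first leaves an identity on each line with $H(y)<\infty$, that is, on almost
   every line. *)
rewrite -[LHS](integral21_prod_meas1 iu) -[RHS](integral21_prod_meas1 ifp).
apply: ae_eq_integral => //.
- exact: (measurable_fubini_G iu).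
- exact: (measurable_fubini_G ifp).
apply: (@filterS _ (almost_everywhere (leb1 R)) _ _ _ _ (ae_H_fin mF F2)) => y Hy _.
rewrite /fubini_G.
have if1 : (leb1 R).-integrable setT (fun x => (f1 F (x, y))%:E).
  apply/integrableP; split.
    by apply/measurable_EFinP; exact: measurable_fun_pair1 (measurable_f1 mF).
  apply: le_lt_trans (integral_f1_le mF F2 Hy) _.
  rewrite -ge0_fin_numE ?sqrte_ge0 //.
  by rewrite sqrte_fin_num ?ge0_fin_numE ?integral_ge0.
have c1 : continuous (derive1 (fun x => phi (x, y)) : R -> R).
  rewrite (_ : derive1 _ = (fun x => pdx phi (x, y))); last first.
    by apply/funext => x; exact: derive1_section.
  move=> x.
  apply: (@continuous_comp _ _ _ (fun x : R => (x, y)) (pdx phi)); last exact: cpdx.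
  by apply: (@cvg_pair _ _ _ _ (nbhs x) (nbhs y)); [exact: cvg_id|exact: cvg_cst].
have z1 x : M < `|x| -> phi (x, y) = 0 by move=> h; rewrite phi0 //= h.
have z2 x : M < `|x| -> derive1 (fun x => phi (x, y)) x = 0.
  by move=> h; rewrite derive1_section (pdx_eq0 phi0) //= h.
have <- := primitive_by_parts if1 (fun x => @derivable_section x y) c1 z1 z2.
by apply: eq_integral => x _; rewrite derive1_section.
Qed.

End by_parts.

(** * Exchanging the coordinates *)

Section test_functions.
Variable R : realType.
Implicit Type phi : R * R -> R.

Lemma swap_quotient phi (z : R * R) :
  (fun h : R => h^-1 *: (((phi \o swap) \o shift z) (h *: ((1 : R), (0 : R))) - (phi \o swap) z)) =
  (fun h : R => h^-1 *: ((phi \o shift (swap z)) (h *: ((0 : R), (1 : R))) - phi (swap z))).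
Proof. by apply/funext => h; case: z. Qed.

Lemma derivable_swap phi z :
  derivable phi (swap z) (0, 1) -> derivable (phi \o swap) z (1, 0).
Proof. by rewrite /derivable swap_quotient. Qed.

Lemma pdx_swap phi z : pdx (phi \o swap) z = pdy phi (swap z).
Proof. by rewrite /pdx /pdy /derive swap_quotient. Qed.

Lemma swap_continuous : continuous (@swap R R).
Proof.
move=> z; apply: (@cvg_pair _ _ _ _ (nbhs z.2) (nbhs z.1)).
  exact: cvg_snd.
exact: cvg_fst.
Qed.

Lemma continuous_comp_swap phi : continuous phi -> continuous (phi \o swap).
Proof.
by move=> cphi z; apply: continuous_comp; [exact: swap_continuous|exact: cphi].
Qed.

(** A compact support is bounded, and the norm of the product is the maximum norm, so a single [M]
    bounds both coordinates. *)
Lemma test_function_supp phi : test_function phi ->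
  exists M, forall z, (M < `|z.1|) || (M < `|z.2|) -> phi z = 0.
Proof.
move=> [_ /compact_bounded [N [_ hN]]]; exists (N + 1) => z hz.
apply: contraTeq hz => phiz; rewrite negb_or -!leNgt.
have : `|z| <= N + 1.
  by apply: (hN (N + 1)); [rewrite ltrDl|exact: subset_closure].
by rewrite prod_normE ge_max.
Qed.

End test_functions.

(** * The divergence identity and both bounds for a square integrable function on the plane *)

Section main.
Variables (R : realType) (F : R * R -> R).
Local Notation T := (measurableTypeR R).
Hypothesis mF : measurable_fun [set: T * T] F.
Hypothesis F2 : (\int[leb2 R]_z (`|F z| ^+ 2)%:E < +oo)%E.

Let mFs : measurable_fun [set: T * T] (F \o swap) := measurable_comp_swap mF.

Lemma sqr_norm_swap : (\int[leb2 R]_z (`|(F \o swap) z| ^+ 2)%:E =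
  \int[leb2 R]_z (`|F z| ^+ 2)%:E)%E.
Proof.
by rewrite -(ge0_integral_swap (measurable_sqr_norm mF)) // => z; rewrite lee_fin.
Qed.

Let Fs2 : (\int[leb2 R]_z (`|(F \o swap) z| ^+ 2)%:E < +oo)%E.
Proof. by rewrite sqr_norm_swap. Qed.

Let u2E : u2 F = u1 (F \o swap) \o swap.
Proof. by apply/funext => z; rewrite /= u1_swap swapK. Qed.

Let f2E : f2 F = f1 (F \o swap) \o swap.
Proof. by apply/funext => z; rewrite /= f1_swap swapK. Qed.

Lemma measurable_u2 : measurable_fun [set: T * T] (u2 F).
Proof. by rewrite u2E; apply: measurable_comp_swap; exact: measurable_u1. Qed.

Lemma ae_norm_u1_le : \forall z \ae leb2 R,
  (`|u1 F z|%:E <= sqrte (\int[leb2 R]_z (`|F z| ^+ 2)%:E))%E.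
Proof.
by have := ae_leb2_snd (ae_H_fin mF F2); apply: ae_leb2S => z; exact: norm_u1_le.
Qed.

Lemma ae_norm_u2_le : \forall z \ae leb2 R,
  (`|u2 F z|%:E <= sqrte (\int[leb2 R]_z (`|F z| ^+ 2)%:E))%E.
Proof.
have := ae_leb2_fst (ae_H_fin mFs Fs2); apply: ae_leb2S => z Hz.
by rewrite u2E -sqr_norm_swap; exact: norm_u1_le.
Qed.

Lemma splitting_div : distributional_div (fun z => (u1 F z, u2 F z)) F.
Proof.
move=> phi tphi; have [M phi0] := test_function_supp tphi.
have cphi : continuous phi := tphi.1 0%N.
have [dx dy cpx cpy] := tphi.1 1%N.
have phis0 z : (M < `|z.1|) || (M < `|z.2|) -> (phi \o swap) z = 0.
  by move=> hz; rewrite /= phi0 //= orbC.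
have cphis := continuous_comp_swap cphi.
have dxs z : derivable (phi \o swap) z (1, 0) by exact: derivable_swap.
have cpxs : continuous (pdx (phi \o swap)).
  rewrite (_ : pdx _ = pdy phi \o swap); first exact: continuous_comp_swap.
  by apply/funext => z; exact: pdx_swap.
have iu1 := u1_mul_integrable mF F2 cpx phi0.
have if1 := f1_mul_integrable mF F2 cphi phi0.
have e1 := u1_by_parts mF F2 cphi dx cpx phi0.
(* The same facts for the swapped data; undoing the swap turns them into facts about $u_2$, $f_2$
   and $\partial_y\varphi$. *)
have iu2s := u1_mul_integrable mFs Fs2 cpxs phis0.
have if2s := f1_mul_integrable mFs Fs2 cphis phis0.
have e2 := u1_by_parts mFs Fs2 cphis dxs cpxs phis0.
have if2 : (leb2 R).-integrable setT (fun z => (f2 F z * phi z)%:E).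
  have := integrable_swap if2s; congr (integrable _ _ _); apply/funext => z.
  by rewrite /= f2E /= swapK.
have iu2 : (leb2 R).-integrable setT (fun z => (u2 F z * pdy phi z)%:E).
  have := integrable_swap iu2s; congr (integrable _ _ _); apply/funext => z.
  by rewrite /= u2E /= pdx_swap swapK.
have ifN1 : (leb2 R).-integrable setT (fun z => (- (f1 F z * phi z))%:E).
  by under eq_fun do rewrite EFinN; exact: integrableN.
have ifN2 : (leb2 R).-integrable setT (fun z => (- (f2 F z * phi z))%:E).
  by under eq_fun do rewrite EFinN; exact: integrableN.
have ifN2s : (leb2 R).-integrable setT (fun z => (- (f1 (F \o swap) z * (phi \o swap) z))%:E).
  by under eq_fun do rewrite EFinN; exact: integrableN.
have e2' : \int[leb2 R]_z (u2 F z * pdy phi z) = \int[leb2 R]_z (- (f2 F z * phi z)).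
  transitivity (\int[leb2 R]_z (u1 (F \o swap) z * pdx (phi \o swap) z)).
    rewrite /Rintegral -(integral_swap iu2s); congr fine; apply: eq_integral => z _.
    by rewrite u2E /= pdx_swap swapK.
  rewrite e2 /Rintegral -(integral_swap ifN2s); congr fine; apply: eq_integral => z _.
  by rewrite f2E /= swapK.
have iF : (leb2 R).-integrable setT (fun z => (F z * phi z)%:E).
  have := integrableD measurableT if1 if2.
  congr (integrable _ _ _); apply/funext => z.
  by rewrite /= -EFinD -mulrDl f1Df2.
transitivity (\int[leb2 R]_z (u1 F z * pdx phi z) + \int[leb2 R]_z (u2 F z * pdy phi z)).
  exact: RintegralD measurableT iu1 iu2.
(* What remains is linearity and $f_1+f_2=F$. *)
rewrite e1 e2' -(RintegralD measurableT ifN1 ifN2).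
rewrite -[RHS]mulN1r -(RintegralZl (-1) measurableT iF); apply: eq_Rintegral => z _.
by rewrite mulN1r -opprD -mulrDl f1Df2.
Qed.

End main.

(** * Comparison with the $L^2$ and $L^\infty$ norms, and the theorem *)

Lemma Lnorm2_sqrte (R : realType) (F : R * R -> R) :
  'N[leb2 R]_2%:E[EFin \o F]%E = sqrte (\int[leb2 R]_z (`|F z| ^+ 2)%:E)%E.
Proof.
rewrite unlock -poweR12_sqrt ?integral_ge0 //; congr (_ `^ _)%E.
by apply: eq_integral => z _; rewrite /= powR_mulrn.
Qed.

(** The $L^\infty$ norm is an essential supremum, except that it is set to 0 on a space of measure
    zero; $0\le N$ settles that branch. *)
Lemma ae_le_Linfty (R : realType) (u : R * R -> R) (N : \bar R) : (0 <= N)%E ->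
  (\forall z \ae leb2 R, (`|u z|%:E <= N)%E) ->
  ('N[leb2 R]_+oo[EFin \o u] <= N)%E.
Proof. by move=> N0 uN; rewrite unlock; case: ifP => // _; apply/ess_supP. Qed.

(* [f \_ Omega] is f extended by 0 outside Omega. *)
Theorem mainTheorem3 (R : realType) (Omega : set (R * R)) (f : R * R -> R)
    (Omega_domain : domain Omega)
    (f_L2 : (f \_ Omega : _ -> R) \in Lfun (leb2 R) 2%:E) :
  let F : R * R -> R := f \_ Omega in
  [/\ u1 F \in Lfun (leb2 R) +oo%E,
      u2 F \in Lfun (leb2 R) +oo%E,
      distributional_div (fun z => (u1 F z, u2 F z)) F,
      ('N[leb2 R]_+oo[EFin \o u1 F] <= 'N[leb2 R]_2%:E[EFin \o F])%E &
      ('N[leb2 R]_+oo[EFin \o u2 F] <= 'N[leb2 R]_2%:E[EFin \o F])%E].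
Proof.
move=> F.
have F2 : (\int[leb2 R]_z (`|F z| ^+ 2)%:E < +oo)%E.
  have /integrableP[_] := Lfun2_integrable_sqr f_L2.
  by under eq_integral do rewrite /= normrX.
have mF : measurable_fun [set: measurableTypeR R * measurableTypeR R] F.
  by have /sub_Lfun_mfun := f_L2; rewrite inE.
have Noo : ('N[leb2 R]_2%:E[EFin \o F] < +oo)%E.
  rewrite Lnorm2_sqrte -ge0_fin_numE ?sqrte_ge0 //.
  by rewrite sqrte_fin_num ?ge0_fin_numE ?integral_ge0.
have N1 : ('N[leb2 R]_+oo[EFin \o u1 F] <= 'N[leb2 R]_2%:E[EFin \o F])%E.
  rewrite Lnorm2_sqrte; apply: ae_le_Linfty; first exact: sqrte_ge0.
  exact: ae_norm_u1_le.
have N2 : ('N[leb2 R]_+oo[EFin \o u2 F] <= 'N[leb2 R]_2%:E[EFin \o F])%E.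
  rewrite Lnorm2_sqrte; apply: ae_le_Linfty; first exact: sqrte_ge0.
  exact: ae_norm_u2_le.
split => //; last exact: splitting_div.
(* Membership in $L^\infty$ means measurability and a finite norm; the latter follows from the bound
   by $\|F\|_2$. *)
- rewrite inE; apply/andP; split; rewrite inE /=; first exact: measurable_u1.
  exact: le_lt_trans N1 Noo.
- rewrite inE; apply/andP; split; rewrite inE /=; first exact: measurable_u2.
  exact: le_lt_trans N2 Noo.
Qed.
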